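(* Let $K$ be a real number field of degree greater than $1$, with $s\ge1$ real embeddings and $2t\ge0$ non-real embeddings into $\mathbb{C}$, labelled $\sigma_1,\dots,\sigma_{s+2t}$ as in the context. Then the set $$\{(\sigma_2(\theta),\dots,\sigma_{s+t}(\theta)) : \theta\in\wp_K\}$$ is dense in $[-1,1]^{s-1}\times\{z\in\mathbb{C} : |z|\le 1\}^{t}$.
   Context: A real number field $K$ is a subfield of $\mathbb{R}$ of finite degree over $\mathbb{Q}$. It has $s\ge1$ real embeddings and $2t\ge 0$ non-real embeddings into $\mathbb{C}$, with $d=s+2t=[K:\mathbb{Q}]$. The distinct embeddings $\sigma_1,\dots,\sigma_d$ of $K$ into $\mathbb{C}$ are labelled so that $\sigma_1$ is the identity (inclusion) of $K$, $\sigma_j$ is real if and only if $j\le s$, and for $j\in\{1,\dots,t\}$ the embedding $\sigma_{s+t+j}$ is the composition of complex conjugation with $\sigma_{s+j}$. A Pisot number is a real algebraic integer greater than $1$ whose other conjugates over $\mathbb{Q}$ are all of modulus less than $1$; $S$ is the set of Pisot numbers, and $$\wp_K:=\{\theta : \theta\in S\cap K \text{ and } K=\mathbb{Q}(\theta)\}.$$ *)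

(* Defs.v *)
From HB Require Import structures.
From mathcomp Require Import all_boot all_order all_algebra all_field.
From mathcomp Require Import complex.
From mathcomp Require Import all_classical all_reals all_analysis.

Set Implicit Arguments.
Unset Strict Implicit.
Unset Printing Implicit Defensive.

Import Order.TTheory GRing.Theory Num.Theory.
Import numFieldNormedType.Exports.

Local Open Scope classical_set_scope.
Local Open Scope ring_scope.
Local Open Scope complex_scope.

(* The real numbers are an arbitrary [R : realType] and the complex numbers are
   [R[i]].  The usual topology lives on the alias [R[i]^o], so points of C^n are
   row vectors over [R[i]^o]; entries are cast back to [R[i]] where the modulus
   is taken.  The modulus takes its values in [R[i]], where [x <= y] means that
   [y - x] is a nonnegative real. *)

Definition is_min_poly (R : realType) (x : R) (p : {poly rat}) : Prop :=
  [/\ p \is monic, irreducible_poly p & root (map_poly ratr p) x].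

Definition conjugates (R : realType) (x : R) : set R[i] :=
  [set z | exists2 p : {poly rat}, is_min_poly x p & root (map_poly ratr p) z].

Definition pisot (R : realType) : set R :=
  [set x | [/\ integralOver (intr : int -> R) x,
               1 < x &
               forall z : R[i], conjugates x z -> z <> x%:C -> `|z| < 1]].

(* A real number field is a finite extension [K] of [rat] together with its
   inclusion [iota] into [R]; an element of [K] is regarded as a real number
   through [iota]. *)
Definition pisot_gen (R : realType) (K : fieldExtType rat)
    (iota : {rmorphism K -> R}) : set K :=
  [set theta | pisot (iota theta) /\ <<1%VS; theta>>%VS = fullv].

(* The embeddings are indexed from 1: only the values of [sigma] at
   [1, ..., s + 2 * t] are meaningful. *)
Record embedding_labelling (R : realType) (K : fieldExtType rat)
    (iota : {rmorphism K -> R}) (s t : nat)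
    (sigma : nat -> {rmorphism K -> R[i]}) : Prop := EmbeddingLabelling {
  labelling_degree : \dim {:K} = (s + 2 * t)%N;
  labelling_distinct : forall j k : nat,
    (1 <= j <= s + 2 * t)%N -> (1 <= k <= s + 2 * t)%N ->
    sigma j =1 sigma k -> j = k;
  labelling_all : forall tau : {rmorphism K -> R[i]},
    exists2 j : nat, (1 <= j <= s + 2 * t)%N & tau =1 sigma j;
  labelling_inclusion : forall x : K, sigma 1%N x = (iota x)%:C;
  labelling_real : forall j : nat, (1 <= j <= s + 2 * t)%N ->
    ((forall x : K, sigma j x \is Num.real) <-> (j <= s)%N);
  labelling_conj : forall j : nat, (1 <= j <= t)%N ->
    forall x : K, sigma (s + t + j)%N x = (sigma (s + j)%N x)^*%C
}.

(* Entries of row vectors are indexed from 0, so entry [j] of the tuple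
   (sigma_2, ..., sigma_(s+t)) is sigma_(j+2). *)
Definition conjugate_tuple (R : realType) (K : fieldExtType rat)
    (s t : nat) (sigma : nat -> {rmorphism K -> R[i]}) (theta : K) :
    'rV[R[i]^o]_(s + t - 1) :=
  \row_(j < s + t - 1) (sigma j.+2 theta : R[i]).

(* The product of s - 1 copies of [-1, 1] and t copies of the closed unit disc,
   as a subset of C^(s+t-1). *)
Definition polydisc (R : realType) (s t : nat) : set 'rV[R[i]^o]_(s + t - 1) :=
  [set z | forall j : 'I_(s + t - 1),
     `|(z ord0 j : R[i])| <= 1 /\
     ((j < s - 1)%N -> (z ord0 j : R[i]) \is Num.real)].

Definition dense_in (T : topologicalType) (A X : set T) : Prop :=
  A `<=` X /\ X `<=` closure A.

(* Main.v *)
(* Fix an integral primitive element g. The embeddings take distinct values on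
   g, so the Vandermonde matrix (sigma_j(g)^i) is invertible and every
   tuple compatible with conjugation is (sum_i x_i sigma_j(g)^i)_j for unique real
   x_i. Solving for the tuple (1, 0, ..., 0) and applying Dirichlet's
   simultaneous approximation to the solution gives a nonzero integral b all of whose
   conjugates sigma_j(b), j >= 2, are tiny. The elements b * Z[g] then form a
   lattice whose image under (sigma_2, ..., sigma_d) is eps-dense, while
   sigma_1 may be prescribed up to a bounded error: so any target of modulus < 1
   is approximated by an integral theta > 1 with |sigma_j(theta)| < 1, j >= 2.
   Such a theta is a Pisot number because its conjugates are the sigma_j(theta),
   and it generates K because sigma_1(theta) is taken by no other embedding. *)

Require Import Defs.
From HB Require Import structures.
From mathcomp Require Import all_boot all_order all_algebra all_field.
From mathcomp Require Import complex.
From mathcomp Require Import all_classical all_reals all_analysis.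
From mathcomp Require Import lra zify.

Set Implicit Arguments.
Unset Strict Implicit.
Unset Printing Implicit Defensive.

Import Order.TTheory GRing.Theory Num.Theory.
Import numFieldNormedType.Exports.

Local Open Scope classical_set_scope.
Local Open Scope ring_scope.
Local Open Scope complex_scope.

(** * Simultaneous Diophantine approximation *)

(** Pigeonhole: the fractional parts of [N ^ n + 1] multiples of [v] fall into [N ^ n] boxes of side
    [1 / N], and the difference of two multiples in the same box gives [q] and [p]. *)
Lemma dirichlet_approximation (R : archiRealFieldType) (n N : nat)
    (v : 'I_n -> R) : (0 < N)%N ->
  exists2 q : nat, (0 < q)%N &
    exists p : 'I_n -> int, forall i, `|q%:R * v i - (p i)%:~R| < N%:R^-1.
Proof.
case: N => // N _.
pose a (k : nat) i : R := k%:R * v i.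
pose frac k i := N.+1%:R * (a k i - (Num.floor (a k i))%:~R).
have frac_ge0 k i : 0 <= frac k i.
  by rewrite mulr_ge0 ?ler0n // subr_ge0 floor_le_tmp.
have frac_lt k i : frac k i < N.+1%:R.
  rewrite -[ltRHS]mulr1 ltr_pM2l ?ltr0n // ltrBlDl -[1 in ltRHS]/(1%:~R).
  by rewrite -intrD floorD1_gt.
pose box (k : 'I_(N.+1 ^ n).+1) :=
  [ffun i : 'I_n => inord (Num.trunc (frac k i)) : 'I_N.+1].
have /injectivePn[k [l neq_kl]] : ~~ injectiveb box.
  apply/negP => /injectiveP/leq_card.
  by rewrite card_ffun !card_ord ltnn.
wlog lt_kl : k l neq_kl / (k < l)%N.
  move=> IH eq_box; have [lt_kl|lt_lk|/val_inj eq_kl] := ltngtP k l.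
  - exact: (IH k l).
  - by apply: (IH l k); rewrite // eq_sym.
  - by rewrite eq_kl eqxx in neq_kl.
move=> eq_box; exists (l - k)%N; first by rewrite subn_gt0.
exists (fun i => Num.floor (a l i) - Num.floor (a k i)) => i.
(* As [frac] stays below [N.+1], [inord] loses nothing, so a common box means equal integer
   parts. *)
have eq_trunc : Num.trunc (frac k i) = Num.trunc (frac l i).
  have /(congr1 val) := congr1 (fun b : {ffun _} => b i) eq_box.
  by rewrite /= !ffunE !inordK // ltnS -ltnS truncn_lt_nat.
have /andP[lk uk] := truncn_itv (frac_ge0 k i).
have /andP[ll ul] := truncn_itv (frac_ge0 l i).
rewrite eq_trunc in lk uk.
rewrite -(ltr_pM2l (_ : 0 < N.+1%:R)) ?ltr0n // mulfV ?pnatr_eq0 //.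
rewrite -[X in X * _]ger0_norm ?ler0n // -normrM.
have -> : N.+1%:R * ((l - k)%:R * v i -
    (Num.floor (a l i) - Num.floor (a k i))%:~R) = frac l i - frac k i.
  rewrite /frac -mulrBr natrB 1?ltnW // mulrBl intrB /a; congr (_ * _).
  by rewrite !opprB addrACA [RHS]addrACA; congr (_ + _); rewrite addrC.
rewrite -natr1 in uk ul.
rewrite ltr_norml; apply/andP; split; lra.
Qed.

(** * Integral generators of a number field *)

Section NumberField.
Variable K : fieldExtType rat.

Lemma fmorph_in_alg (F : unitRingType) (f : {rmorphism K -> F})
    (p : {poly rat}) :
  map_poly f (map_poly (in_alg K) p) = map_poly ratr p.
Proof.
rewrite -map_poly_comp; apply: eq_map_poly => a /=.
exact: (fmorph_eq_rat (f \o in_alg K)).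
Qed.

Lemma integral_multiple (x : K) :
  exists2 N : int, N != 0 & integralOver (intr : int -> K) (N%:~R * x).
Proof.
have /polyOver1P[p def_p] := minPolyOver 1 x.
have [q [a a_neq0 def_q]] := rat_poly_scale p.
have p_monic : map_poly (in_alg K) p \is monic by rewrite -def_p monic_minPoly.
have p_root : root (map_poly (in_alg K) p) x by rewrite -def_p root_minPoly.
exists a => //.
pose P := map_poly (in_alg K) p; pose n := (size P).-1.
have szP : size P = n.+1.
  by rewrite prednK // lt0n size_poly_eq0 monic_neq0.
(* Q is a ^ n * P (X / a), whose nonleading coefficients are integral. *)
pose Q := \poly_(i < n.+1) (P`_i * a%:~R ^+ (n - i)).
have Qn : Q`_n = 1.
  by rewrite coef_poly ltnSn subnn mulr1 -(monicP p_monic) lead_coefE.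
have Q_size : size Q = n.+1.
  rewrite size_poly_eq // subnn mulr1 -lead_coefE.
  by rewrite (monicP p_monic) oner_eq0.
have Q_monic : Q \is monic by rewrite monicE lead_coefE Q_size Qn.
apply: (integral_root_monic Q_monic).
- rewrite /root horner_poly.
  rewrite (eq_bigr (fun i : 'I_n.+1 => a%:~R ^+ n * (P`_i * x ^+ i))).
    rewrite -mulr_sumr -szP -horner_coef.
    by move/rootP: p_root => ->; rewrite mulr0.
  move=> i _; rewrite exprMn mulrA -[X in X * _]mulrA -exprD subnK -1?ltnS //.
  by rewrite -mulrA mulrCA.
- apply/integral_poly => i; rewrite coef_poly.
  case: ltnP => [lt_in|_]; last first.
    exact: mxpoly.integral0.
  case: (ltngtP i n) => [lt_i|gt_i|->]; last first.
  + rewrite subnn mulr1 -lead_coefE (monicP p_monic); exact: mxpoly.integral1.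
  + by rewrite ltnNge gt_i in lt_in.
  (* One factor [a] clears the denominator of the coefficient of [P]; the remaining power of [a] is
     an integer. *)
  have -> : (n - i)%N = (n - i.+1).+1 by rewrite subnSK.
  rewrite exprS mulrA; apply: integral_mul; last first.
    by rewrite -rmorphXn; apply: integral_id.
  have -> : P`_i * a%:~R = (q`_i)%:~R.
    rewrite -(rmorph_int (in_alg K) a) /P coef_map -rmorphM def_q coefZ.
    by rewrite coef_map mulrAC mulVf ?intr_eq0 // mul1r rmorph_int.
  exact: integral_id.
Qed.

(** The primitive element theorem applies in characteristic 0, and scaling a generator by a nonzero
    integer leaves the field it generates unchanged. *)
Lemma integral_generator :
  exists2 g : K, <<1; g>>%VS = fullv & integralOver (intr : int -> K) g.
Proof.
have sepK : separable 1 {:K}.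
  apply/separableP => x _; apply: pcharf0_separable.
  by move=> p; rewrite (fmorph_pchar (in_alg K)) pchar_num.
have := eq_adjoin_separable_generator sepK (sub1v _).
set g := separable_generator _ _ => def_K.
have [N N_neq0 int_g] := integral_multiple g.
exists (N%:~R * g) => //.
apply/eqP; rewrite eqEsubv subvf def_K; apply/FadjoinP.
split; first exact: subv_adjoin.
have NK_neq0 : N%:~R != 0 :> K.
  by rewrite -(rmorph_int (in_alg K)) fmorph_eq0 intr_eq0.
rewrite -[g in g \in _](mulKf NK_neq0) rpredM ?memv_adjoin //.
by rewrite rpredV rpred_int.
Qed.

Lemma generator_horner (g x : K) : <<1; g>>%VS = fullv ->
  exists2 p : {poly rat}, (size p <= \dim {:K})%N &
    x = (map_poly (in_alg K) p).[g].
Proof.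
move=> gen_g; have /polyOver1P[p def_p] := Fadjoin_polyOver 1 g x.
exists p; last by rewrite -def_p Fadjoin_poly_eq // gen_g memvf.
rewrite -(size_map_poly (in_alg K)) -def_p.
apply: leq_trans (size_Fadjoin_poly _ _ _) _.
by rewrite -gen_g dim_Fadjoin dimv1 muln1.
Qed.

Lemma generator_fmorph_eq (F : unitRingType) (g : K)
    (f h : {rmorphism K -> F}) :
  <<1; g>>%VS = fullv -> f g = h g -> f =1 h.
Proof.
move=> gen_g eq_g x; have [p _ ->] := generator_horner x gen_g.
by rewrite -!horner_map /= !fmorph_in_alg eq_g.
Qed.

End NumberField.

(** * Interpolation of prescribed values at the embeddings *)

Section Labelling.
Variables (R : realType) (K : fieldExtType rat) (iota : {rmorphism K -> R}).
Variables (s t : nat) (sigma : nat -> {rmorphism K -> R[i]}).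
Hypothesis hs : (1 <= s)%N.
Hypothesis hsigma : embedding_labelling iota s t sigma.
Variable g : K.
Hypothesis gen_g : <<1; g>>%VS = fullv.

Local Notation d := (s + 2 * t)%N.

Lemma sigma_generator_inj (x : K) (j k : nat) : <<1; x>>%VS = fullv ->
  (1 <= j <= d)%N -> (1 <= k <= d)%N -> sigma j x = sigma k x -> j = k.
Proof.
move=> gen_x lej lek eq_x; apply: (labelling_distinct hsigma lej lek).
exact: generator_fmorph_eq gen_x eq_x.
Qed.

Definition power_basis_mx : 'M[R[i]]_d :=
  Vandermonde d (\row_(j < d) sigma j.+1 g).

Lemma power_basis_mxE (i j : 'I_d) : power_basis_mx i j = sigma j.+1 g ^+ i.
Proof. by rewrite !mxE. Qed.

Lemma power_basis_unitmx : power_basis_mx \in unitmx.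
Proof.
rewrite unitmxE det_Vandermonde unitfE; apply/prodf_neq0 => i _.
apply/prodf_neq0 => j lt_ij; rewrite !mxE subr_eq0; apply/eqP.
move=> /(sigma_generator_inj gen_g) -/(_ (ltn_ord j) (ltn_ord i)) [eq_ij].
by rewrite eq_ij ltnn in lt_ij.
Qed.

(* A complex solution exists by invertibility of the Vandermonde matrix; when
   the right-hand side is compatible with complex conjugation, its real part is
   again a solution. *)
Lemma real_interpolation (y : nat -> R[i]) :
    (forall j, (1 <= j <= s)%N -> y j \is Num.real) ->
  exists x : 'I_d -> R, forall j, (1 <= j <= s + t)%N ->
    \sum_i (x i)%:C * sigma j g ^+ i = y j.
Proof.
move=> y_real.
(* Extends the target to all [d] embeddings: an index [j = s + t + k] receives the conjugate of the
   value at [j - t = s + k]. *)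
pose Y (j : nat) := if (j <= s + t)%N then y j else (y (j - t)%N)^*%C.
pose X := (\row_(j < d) Y j.+1) *m invmx power_basis_mx.
have XE j : (1 <= j <= d)%N -> \sum_i X 0 i * sigma j g ^+ i = Y j.
  case: j => // j /= lt_jd.
  have: (X *m power_basis_mx) 0 (Ordinal lt_jd) = Y j.+1.
    by rewrite mulmxKV ?power_basis_unitmx // mxE.
  by rewrite mxE => <-; apply: eq_bigr => i _; rewrite power_basis_mxE.
(* The index of the conjugate embedding is [j] itself in the real case and [j + t] otherwise. *)
have conj_index j : (1 <= j <= s + t)%N -> exists2 k, (1 <= k <= d)%N &
    sigma k g = (sigma j g)^*%C /\ Y k = (y j)^*%C.
  move=> /andP[j_gt0 le_jst]; have [le_js|lt_sj] := leqP j s.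
    have le_jd : (1 <= j <= d)%N.
      by rewrite j_gt0 (leq_trans le_js) ?leq_addr.
    exists j => //; rewrite /Y le_jst.
    have/complex_realP[a ->]: sigma j g \is Num.real.
      by have [_ H] := labelling_real hsigma le_jd; apply: H.
    have /complex_realP[b ->] : y j \is Num.real by rewrite y_real ?j_gt0.
    by rewrite !conjc_real.
  exists (j + t)%N.
    by rewrite (leq_trans j_gt0) ?leq_addr //= mul2n -addnn addnA leq_add2r.
  rewrite /Y addnK leq_add2r leqNgt lt_sj; split=> //.
  have le_jt : (1 <= j - s <= t)%N by rewrite subn_gt0 lt_sj leq_subLR.
  have := labelling_conj hsigma le_jt g.
  by rewrite addnAC [(s + _)%N]subnKC // ltnW.
exists (fun i => complex.Re (X 0 i)) => j le_j.
have [k le_k [sig_k Yk]] := conj_index j le_j.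
have sum_conj : \sum_i (X 0 i)^*%C * sigma j g ^+ i = y j.
  apply: (inv_inj (@conjcK R)); rewrite -Yk -(XE k le_k) rmorph_sum.
  by apply: eq_bigr => i _; rewrite rmorphM rmorphXn /= conjcK sig_k.
have sum_X : \sum_i X 0 i * sigma j g ^+ i = y j.
  have /andP[j_gt0 le_jst] := le_j.
  rewrite XE /Y ?le_jst // j_gt0 (leq_trans le_jst) // leq_add2l.
  by rewrite mul2n -addnn leq_addr.
transitivity ((y j + y j) / 2%:R); last first.
  by rewrite -mulr2n -(mulr_natr (y j)) mulfK ?pnatr_eq0.
rewrite -{1}sum_X -sum_conj -big_split mulr_suml; apply: eq_bigr => i _ /=.
by rewrite ReJ_add -mulrDl mulrAC.
Qed.

(** * Approximation by algebraic integers *)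

Lemma sigma_powers_bounded : exists2 B : R, 0 < B &
  forall (j : nat) (e : R) (a : 'I_d -> R[i]), 0 <= e -> (j <= s + t)%N ->
    (forall i, `|a i| <= e%:C) -> `|\sum_i a i * sigma j g ^+ i| <= (e * B)%:C.
Proof.
pose c j := \sum_(i < d) complex.Re `|sigma j g ^+ i|.
have c_ge0 j : 0 <= c j.
  by apply: sumr_ge0 => i _; rewrite -ler0c RRe_real ?normr_real.
(* Summing over [j] gives one constant for all embeddings, and the 1 makes it positive. *)
exists (1 + \sum_(j < (s + t).+1) c j).
  by rewrite ltr_pwDl // sumr_ge0.
move=> j e a e_ge0 le_j a_le; apply: le_trans (ler_norm_sum _ _ _) _.
apply: (@le_trans _ _ (e * c j)%:C).
  rewrite mulr_sumr rmorph_sum; apply: ler_sum => i _.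
  rewrite normrM rmorphM [X in _ <= _ * X]RRe_real ?normr_real //.
  by rewrite ler_wpM2r ?a_le.
rewrite lecR ler_wpM2l // (bigD1 (inord j)) //= inordK // addrCA lerDl.
by rewrite addr_ge0 // sumr_ge0.
Qed.

Lemma int_combination_integral (p : 'I_d -> int) :
  integralOver (intr : int -> K) g ->
  integralOver (intr : int -> K) (\sum_i (p i)%:~R * g ^+ i).
Proof.
move=> int_g.
have -> : \sum_i (p i)%:~R * g ^+ i =
    (\poly_(i < d) (\sum_(j < d | j == i :> nat) (p j)%:~R)).[g].
  rewrite horner_poly; apply: eq_bigr => i _; congr (_ * _).
  by rewrite (big_pred1 i).
apply: integral_horner => //; apply/integral_poly => i; rewrite coef_poly.
case: ifP => _; last exact: mxpoly.integral0.
by rewrite -rmorph_sum; apply: integral_id.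
Qed.

(** The real coordinates [v] of [(1, 0, ..., 0)] satisfy [q * v] close to [p], so the integral
    element with coordinates [p] has conjugates close to [(q, 0, ..., 0)]. *)
Lemma small_integral_element (e : R) : 0 < e ->
    integralOver (intr : int -> K) g ->
  exists b : K, [/\ b != 0, integralOver (intr : int -> K) b &
    forall j, (2 <= j <= s + t)%N -> `|sigma j b| < e%:C].
Proof.
move=> e_gt0 int_g; have [B B_gt0 sum_le] := sigma_powers_bounded.
have [|v v_sum] := @real_interpolation (fun j => (j == 1)%:R).
  by move=> j _; apply: realn.
(* Ensures [B / N < e], for smallness at [j >= 2], and [B / N < 1 <= q], which keeps [sigma 1 b]
   away from 0. *)
pose N := (Num.trunc (B / Num.min e 1)).+1.
have N_gt0 : 0 < N%:R :> R by rewrite ltr0n.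
have m_gt0 : 0 < Num.min e 1 by rewrite lt_min e_gt0 ltr01.
have /andP[B_e B_1] : (B / N%:R < e) && (B / N%:R < 1).
  rewrite -lt_min ltr_pdivrMr // mulrC -ltr_pdivrMr //.
  have /andP[//] := truncn_itv (ltW (divr_gt0 B_gt0 m_gt0)).
have [q q_gt0 [p p_approx]] := dirichlet_approximation v (ltn0Sn _ : (0 < N)%N).
exists (\sum_i (p i)%:~R * g ^+ i).
have sigma_b j : (1 <= j <= s + t)%N ->
    `|q%:R * (j == 1)%:R - sigma j (\sum_i (p i)%:~R * g ^+ i)|
      <= (B / N%:R)%:C.
  move=> le_j; rewrite -v_sum // rmorph_sum mulr_sumr -sumrB.
  under eq_bigr => i _ do
    rewrite rmorphM rmorph_int rmorphXn mulrA -mulrBl.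
  rewrite [B / _]mulrC; apply: sum_le => [||i].
  - by rewrite invr_ge0 ltW.
  - by case/andP: le_j.
  rewrite -(rmorph_nat (real_complex R)) -(rmorph_int (real_complex R)).
  rewrite -rmorphM -rmorphB.
  by rewrite normc_def /= expr0n addr0 sqrtr_sqr lecR ltW.
split.
- apply/eqP => b0; have /sigma_b : (1 <= 1 <= s + t)%N by rewrite addn_gt0 hs.
  rewrite b0 rmorph0 subr0 mulr1 normr_nat -(rmorph_nat (real_complex R)) lecR.
  by apply/negP; rewrite -ltNge (lt_le_trans B_1) // ler1n.
- exact: int_combination_integral.
- move=> j /andP[lt1j le_j].
  have /sigma_b : (1 <= j <= s + t)%N by rewrite ltnW.
  by rewrite gtn_eqF // mulr0 sub0r normrN => /le_lt_trans; apply; rewrite ltcR.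
Qed.

(** After division of the target by [sigma j b], rounding the real coordinates down costs at most
    [B]; multiplying back by [b] shrinks this error below [e] when [j >= 2]. *)
Lemma integral_approximation (y : nat -> R[i]) (e : R) : 0 < e ->
    integralOver (intr : int -> K) g ->
    (forall j, (2 <= j <= s)%N -> y j \is Num.real) ->
  exists theta : K, [/\ integralOver (intr : int -> K) theta, 1 < iota theta &
    forall j, (2 <= j <= s + t)%N -> `|sigma j theta - y j| < e%:C].
Proof.
move=> e_gt0 int_g y_real; have [B B_gt0 sum_le] := sigma_powers_bounded.
have [b [b_neq0 int_b b_small]] :=
  small_integral_element (divr_gt0 e_gt0 B_gt0) int_g.
(* At [j = 1] the error is at most [|iota b| * B], so this value forces [iota theta >= 2]. *)
pose y' j := if j == 1%N then (2 + `|iota b| * B)%:C else y j.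
have [|x x_sum] := @real_interpolation (fun j => y' j / sigma j b).
  move=> j /andP[j_gt0 le_js]; apply: rpred_div; last first.
    have le_jd : (1 <= j <= d)%N by rewrite j_gt0 (leq_trans le_js) ?leq_addr.
    by have [_ H] := labelling_real hsigma le_jd; apply: H.
  rewrite /y'; case: eqP => [_|/eqP neq_j1].
    by apply/complex_realP; eexists.
  by apply: y_real; rewrite ltn_neqAle eq_sym neq_j1 j_gt0.
pose n i := Num.floor (x i).
pose theta := b * \sum_i (n i)%:~R * g ^+ i.
have theta_near j : (1 <= j <= s + t)%N ->
    `|sigma j theta - y' j| <= `|sigma j b| * B%:C.
  move=> le_j.
  have -> : y' j = sigma j b * \sum_i (x i)%:C * sigma j g ^+ i.
    by rewrite x_sum // mulrC divfK // fmorph_eq0.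
  rewrite rmorphM -mulrBr normrM ler_wpM2l // rmorph_sum -sumrB.
  under eq_bigr => i _ do
    rewrite rmorphM rmorph_int rmorphXn -mulrBl.
  rewrite -[B]mul1r; apply: sum_le => [||i] //; first by case/andP: le_j.
  rewrite -(rmorph_int (real_complex R)) -rmorphB.
  rewrite normc_def /= expr0n addr0 sqrtr_sqr lecR distrC.
  rewrite ger0_norm ?subr_ge0 ?floor_le_tmp // lerBlDl -[1 in leRHS]/(1%:~R).
  by rewrite -intrD ltW // floorD1_gt.
exists theta; split.
- by apply: integral_mul => //; apply: int_combination_integral.
- have /theta_near : (1 <= 1 <= s + t)%N by rewrite addn_gt0 hs.
  rewrite !(labelling_inclusion hsigma) /y' eqxx -rmorphB.
  rewrite !normc_def /= !expr0n !addr0 !sqrtr_sqr -rmorphM lecR ler_norml.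
  by move=> /andP[+ _]; lra.
- move=> j /andP[lt1j le_j].
  have /theta_near : (1 <= j <= s + t)%N by rewrite ltnW.
  rewrite /y' gtn_eqF // => /le_lt_trans; apply.
  have -> : e%:C = (e / B)%:C * B%:C by rewrite -rmorphM divfK // gt_eqF.
  by rewrite ltr_pM2r; [apply: b_small; rewrite lt1j | rewrite ltcR].
Qed.

(** * Conjugates and generators in terms of the embeddings *)

Lemma min_poly_exists (theta : K) : exists2 p : {poly rat},
  is_min_poly (iota theta) p & minPoly 1 theta = map_poly (in_alg K) p.
Proof.
have /polyOver1P[p def_p] := minPolyOver 1 theta; exists p => //; split.
- by rewrite -(map_monic (in_alg K)) -def_p monic_minPoly.
- split; first by rewrite -(size_map_poly (in_alg K)) -def_p size_minPoly.
  move=> q sz_q; rewrite -(dvdp_map (in_alg K)) -(eqp_map (in_alg K)) -def_p.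
  move=> /(minPoly_irr (alg_polyOver _ _))/orP[] // /eqp_size.
  by rewrite size_map_poly size_poly1 => /eqP; rewrite (negPf sz_q).
- by rewrite -(fmorph_in_alg iota) -def_p fmorph_root root_minPoly.
Qed.

Lemma sigma_conjugate (theta : K) (j : nat) :
  conjugates (iota theta) (sigma j theta).
Proof.
have [p min_p def_p] := min_poly_exists theta; exists p => //.
by rewrite -(fmorph_in_alg (sigma j)) -def_p fmorph_root root_minPoly.
Qed.

(* In the power basis of [g], multiplication by [theta] has a rational matrix,
   which [power_basis_mx] diagonalizes with eigenvalues the [sigma j theta]; so
   the minimal polynomial of [theta] divides its characteristic polynomial. *)
Lemma conjugate_sigma (theta : K) (z : R[i]) : conjugates (iota theta) z ->
  exists2 j, (1 <= j <= d)%N & z = sigma j theta.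
Proof.
case=> p [_ p_irr p_root] p_z.
have mul_g (i : 'I_d) : exists q : {poly rat}, (size q <= d)%N /\
    theta * g ^+ i = (map_poly (in_alg K) q).[g].
  have [q sz_q def_q] := generator_horner (theta * g ^+ i) gen_g.
  by exists q; split=> //; rewrite -(labelling_degree hsigma).
have /choice[q q_spec] := mul_g.
pose M : 'M[rat]_d := \matrix_(i, k) (q i)`_k.
pose E := power_basis_mx.
pose D := \row_(j < d) sigma j.+1 theta.
have ME : map_mx ratr M *m E = E *m diag_mx D.
  apply/matrixP => i j; rewrite mul_mx_diag mxE [RHS]mxE power_basis_mxE mxE.
  have [sz_q def_q] := q_spec i.
  rewrite mulrC -rmorphXn -rmorphM /= def_q -horner_map /= fmorph_in_alg.
  rewrite (@horner_coef_wide _ d) ?size_map_poly //; apply: eq_bigr => k _.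
  by rewrite power_basis_mxE !mxE coef_map.
have E_unit : E \in unitmx by exact: power_basis_unitmx.
have d_gt0 : (0 < d)%N by rewrite addn_gt0 hs.
pose P := char_poly M.
have P_root (w : R[i]) :
    eigenvalue (map_mx ratr M) w = root (map_poly ratr P) w.
  by rewrite eigenvalue_root_char /P map_char_poly.
have P_theta : root (map_poly ratr P) (iota theta)%:C.
  (* The first row of the inverse of [E] is a left eigenvector of [M] with eigenvalue
     [sigma 1 theta]. *)
  rewrite -P_root; apply/eigenvalueP; pose i0 := Ordinal d_gt0.
  have v_def : delta_mx 0 i0 *m invmx E *m E = delta_mx (0 : 'I_1) i0.
    by rewrite mulmxKV.
  exists (delta_mx 0 i0 *m invmx E); last first.
    apply: contra_eq_neq v_def => ->; rewrite mul0mx eq_sym.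
    by apply/eqP => /matrixP/(_ 0 i0)/eqP; rewrite !mxE !eqxx oner_eq0.
  apply: (can_inj (mulmxK E_unit)).
  rewrite -mulmxA ME mulmxA v_def -scalemxAl v_def.
  apply/rowP => j; rewrite mul_mx_diag !mxE eqxx /=.
  have [->|_] := eqVneq j i0; last by rewrite mulr0 mul0r.
  by rewrite mulr1 mul1r (labelling_inclusion hsigma).
have p_theta : root (map_poly ratr p) (iota theta)%:C.
  rewrite -(eq_map_poly (fmorph_eq_rat (real_complex R \o ratr))) map_poly_comp.
  by rewrite fmorph_root.
(* Otherwise the irreducible [p] would be coprime to [P], also over [R[i]], against their common
   root [iota theta]. *)
have p_P : p %| P.
  apply: contraT; rewrite -irreducible_poly_coprime //.
  rewrite -(coprimep_map (ratr : {rmorphism rat -> R[i]})) => /coprimep_root.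
  by move=> /(_ _ p_theta); rewrite (rootP P_theta) eqxx.
have : root (map_poly ratr P) z.
  by have /dvdpP[r ->] := p_P; rewrite rmorphM rootM [X in _ || X]p_z orbT.
rewrite -P_root => /eigenvalueP[v v_M v_neq0].
(* [v *m E] is an eigenvector of the diagonal matrix, so [z] is the diagonal entry wherever it does
   not vanish. *)
have /rV0Pn[j w_j] : v *m E != 0.
  by apply: contra_neq v_neq0 => vE0; rewrite -(mulmxK E_unit v) vE0 mul0mx.
exists j.+1; first exact: ltn_ord.
apply: (mulIf w_j).
have /rowP/(_ j) : v *m E *m diag_mx D = z *: (v *m E).
  by rewrite -mulmxA -ME mulmxA v_M scalemxAl.
by rewrite mul_mx_diag mxE [RHS]mxE [D 0 j]mxE => <-; rewrite mulrC.
Qed.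

(** Let [h] be the minimal polynomial of [g] over the field generated by [theta]. The roots of its
    image under [sigma 1] are distinct values [sigma j g], each with
    [sigma j theta = sigma 1 theta]. Only [j = 1] remains, so [h] is linear and [g] lies in that
    field. *)
Lemma generator_of_isolated_value (theta : K) :
    (forall j, (2 <= j <= d)%N -> sigma j theta <> sigma 1%N theta) ->
  <<1; theta>>%VS = fullv.
Proof.
move=> isolated; pose F := <<1; theta>>%AS; pose h := minPoly F g.
have [m min_m def_m] := min_poly_exists g.
have d_gt0 : (0 < d)%N by rewrite addn_gt0 hs.
have def_prod : map_poly ratr m = \prod_(j < d) ('X - (sigma j.+1 g)%:P).
  have [m_monic _ _] := min_m.
  rewrite (@all_roots_prod_XsubC _ (map_poly ratr m)
    [seq sigma (val j).+1 g | j <- index_enum 'I_d]).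
  - have /monicP -> : map_poly ratr m \is @monic R[i] by rewrite map_monic.
    by rewrite scale1r big_map.
  - rewrite size_map_poly size_map -(size_map_poly (in_alg K)) -def_m.
    rewrite size_minPoly -[index_enum _]enumT size_enum_ord.
    by rewrite -(labelling_degree hsigma) -gen_g dim_Fadjoin dimv1 muln1.
  - apply/allP => _ /mapP[j _ ->]; rewrite -(fmorph_in_alg (sigma j.+1)) -def_m.
    by rewrite fmorph_root root_minPoly.
  - rewrite uniq_rootsE map_inj_in_uniq ?index_enum_uniq // => i j _ _.
    move=> /(sigma_generator_inj gen_g) -/(_ (ltn_ord i) (ltn_ord j)) [].
    exact: val_inj.
have : map_poly (sigma 1%N) h %| \prod_(j < d) ('X - (sigma j.+1 g)%:P).
  rewrite -def_prod -(fmorph_in_alg (sigma 1%N)) -def_m dvdp_map.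
  exact: minPolyS (sub1v _).
case/dvdp_prod_XsubC => b; set r := mask b _ => h_r.
have [q _ def_theta] := generator_horner theta gen_g.
(* With [theta = q(g)], [h] divides [q - theta]; applying [sigma 1] to the coefficients and
   evaluating at the root [sigma j.+1 g] gives [sigma j.+1 theta = sigma 1 theta]. *)
have r_first j : j \in r -> j = Ordinal (d_gt0 : 0 < d)%N.
  move=> r_j; apply/val_inj => /=; case: (posnP j) => // j_gt0.
  case: (isolated j.+1); first by rewrite ltnS j_gt0 ltn_ord.
  have /dvdpP[u def_u] : h %| map_poly (in_alg K) q - theta%:P.
    apply: minPoly_dvdp; last by rewrite rootE !hornerE -def_theta subrr.
    by rewrite rpredB ?alg_polyOver // polyOverC memv_adjoin.
  have /rootP : root (map_poly (sigma 1%N) h) (sigma j.+1 g).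
    by rewrite (eqp_root h_r) -(big_map (fun j : 'I_d => sigma j.+1 g) xpredT
      (fun a => 'X - a%:P)) root_prod_XsubC; apply/mapP; exists j.
  move=> h0; have :=
    congr1 (fun p => (map_poly (sigma 1%N) p).[sigma j.+1 g]) def_u.
  rewrite rmorphM rmorphB /= hornerM h0 mulr0 hornerD hornerN fmorph_in_alg.
  rewrite map_polyC hornerC -(fmorph_in_alg (sigma j.+1)) horner_map -def_theta.
  by move/eqP; rewrite subr_eq0 => /eqP.
have : (size h <= 2)%N.
  rewrite -(size_map_poly (sigma 1%N)) (eqp_size h_r) size_prod_XsubC ltnS.
  apply: (@uniq_leq_size _ r [:: Ordinal d_gt0]).
    by rewrite mask_uniq // index_enum_uniq.
  by move=> j /r_first ->; rewrite inE.
rewrite size_minPoly ltnS => le_deg1.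
have g_F : g \in F by rewrite -adjoin_deg_eq1 eqn_leq le_deg1.
apply/eqP; rewrite eqEsubv subvf -gen_g; apply/FadjoinP; split=> //.
exact: sub1v.
Qed.

(** * Pisot generators characterized by their conjugates *)

Lemma pisot_gen_criterion (theta : K) : integralOver (intr : int -> K) theta ->
    1 < iota theta ->
    (forall j, (2 <= j <= d)%N -> `|sigma j theta| < 1) ->
  pisot_gen iota theta.
Proof.
move=> int_theta gt1 lt1; split; last first.
  apply: generator_of_isolated_value => j /lt1 + eq_j.
  rewrite eq_j (labelling_inclusion hsigma) normc_def /= expr0n addr0 sqrtr_sqr.
  rewrite -(rmorph1 (real_complex R)) ltcR gtr0_norm ?(lt_trans ltr01) //.
  by rewrite ltNge ltW.
split=> // [|z /conjugate_sigma[j le_j ->] neq_j].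
  have [p p_monic p_root] := integral_rmorph iota int_theta.
  by exists p => //; rewrite -(eq_map_poly (rmorph_int iota)).
apply: lt1; rewrite ltn_neqAle; case/andP: le_j => -> ->; rewrite !andbT.
by apply: contra_not_neq neq_j => <-; rewrite (labelling_inclusion hsigma).
Qed.

Lemma pisot_gen_sigma_lt1 (theta : K) (j : nat) : pisot_gen iota theta ->
  (2 <= j <= d)%N -> `|sigma j theta| < 1.
Proof.
move=> [[_ _ conj_lt1] gen_theta] /andP[lt1j le_jd].
apply: conj_lt1; first exact: sigma_conjugate.
(* Since [theta] generates [K], its values under distinct embeddings differ, so for [j >= 2] this
   conjugate is not [iota theta]. *)
rewrite -(labelling_inclusion hsigma) => /(sigma_generator_inj gen_theta).
rewrite le_jd (ltnW lt1j) addn_gt0 hs => /(_ isT isT) j1.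
by rewrite j1 in lt1j.
Qed.

End Labelling.

(** * Density in the polydisc *)

Theorem corollary2 (R : realType) (K : fieldExtType rat)
    (iota : {rmorphism K -> R}) (s t : nat)
    (sigma : nat -> {rmorphism K -> R[i]})
    (hK : (1 < \dim {:K})%N) (hs : (1 <= s)%N)
    (hsigma : embedding_labelling iota s t sigma) :
  dense_in [set conjugate_tuple s t sigma theta | theta in pisot_gen iota]
           (@polydisc R s t).
Proof.
have [g gen_g int_g] := integral_generator K.
have lt_index (j : 'I_(s + t - 1)) : (j.+2 <= s + t)%N.
  by have := ltn_ord j; lia.
have le_std : (s + t <= s + 2 * t)%N by rewrite leq_add2l mul2n -addnn leq_addr.
split=> [_ [theta theta_pisot <-] j|z z_disc B].
  have le_jd : (j.+2 <= s + 2 * t)%N by apply: leq_trans (lt_index j) le_std.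
  rewrite mxE; split; first by apply/ltW/(pisot_gen_sigma_lt1 hs hsigma).
  move=> lt_js; have [_ real_j] := labelling_real hsigma (j := j.+2) le_jd.
  by apply: real_j; lia.
case/nbhs_ballP => e /= e_gt0 ball_B.
(* The radius [e] is a positive element of [R[i]], hence real; the cap at 1 keeps the factor [c]
   below nonnegative. *)
pose r : R := Num.min (complex.Re e) 1.
have r_gt0 : 0 < r.
  by rewrite lt_min ltr01 andbT; move: e_gt0; rewrite ltcE => /andP[].
have r_le1 : r <= 1 by rewrite ge_min lexx orbT.
have r_le_e : r%:C <= e.
  by rewrite -(RRe_real (gtr0_real e_gt0)) lecR ge_min lexx.
(* Shrinking the target by [c] leaves room for an error [r / 2]: the approximant has modulus below
   [c + r / 2 = 1] and lies within [r / 2 + r / 2 = r] of [z]. *)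
pose c : R := 1 - r / 2.
have c_ge0 : 0 <= c by rewrite /c; lra.
have norm_c : `|c%:C| = c%:C :> R[i] by rewrite ger0_norm ?ler0c.
(* Entry [i] of [z] belongs to the embedding [i + 2]; 0 is a filler for indices beyond [s + t]. *)
pose y (j : nat) : R[i] :=
  if insub (j - 2)%N is Some i then c%:C * (z ord0 i : R[i]) else 0.
have yE (i : 'I_(s + t - 1)) : y i.+2 = c%:C * (z ord0 i : R[i]).
  by rewrite /y subn2 /= valK.
have y_real j : (2 <= j <= s)%N -> y j \is Num.real.
  move=> /andP[lt1j le_js]; rewrite /y; case: insubP => [i _ def_i|_] //.
  rewrite realM //; first by apply/complex_realP; exists c.
  apply: (z_disc i).2; rewrite -[nat_of_ord i]/(val i) def_i; lia.
have r2_gt0 : 0 < r / 2 by rewrite divr_gt0.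
have [theta [int_theta gt1 near]] :=
  integral_approximation hs hsigma gen_g r2_gt0 int_g y_real.
have near_z (i : 'I_(s + t - 1)) :
    `|sigma i.+2 theta - c%:C * z ord0 i| < (r / 2)%:C.
  by rewrite -yE; apply: near; rewrite lt_index.
have lt1 j : (2 <= j <= s + t)%N -> `|sigma j theta| < 1.
  case: j => [|[|j]] // /andP[_ le_j].
  have lt_j : (j < s + t - 1)%N by lia.
  have := near_z (Ordinal lt_j); set w := z _ _ => near_w.
  rewrite -(subrK (c%:C * w) (sigma j.+2 theta)).
  apply: le_lt_trans (ler_normD _ _) _.
  have -> : 1 = (r / 2)%:C + c%:C :> R[i] by rewrite -rmorphD /= /c addrC subrK.
  apply: ltr_leD => //.
  rewrite normrM norm_c -[leRHS]mulr1 ler_wpM2l ?ler0c //.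
  exact: (z_disc _).1.
exists (conjugate_tuple s t sigma theta); split.
  exists theta => //; apply: (pisot_gen_criterion hs hsigma gen_g) => // j.
  move=> /andP[lt1j le_jd]; have [le_j|lt_j] := leqP j (s + t).
    by apply: lt1; rewrite lt1j.
  (* The remaining embeddings are complex conjugates of earlier ones and give the same modulus. *)
  have le_k : (1 <= j - (s + t) <= t)%N by lia.
  have := labelling_conj hsigma le_k theta; rewrite subnKC 1?ltnW // => ->.
  by rewrite normcJ; apply: lt1; lia.
apply: ball_B; split=> // i j; rewrite (ord1 i) {i} -ball_normE /ball_ /= mxE.
set w := z ord0 j; apply: lt_le_trans r_le_e.
have -> : r%:C = (r / 2)%:C + (r / 2)%:C :> R[i] by rewrite -rmorphD -splitr.
have -> : w - sigma j.+2 theta = (r / 2)%:C * w - (sigma j.+2 theta - c%:C * w).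
  rewrite opprB addrA -mulrDl -rmorphD /= /c [r / 2 + _]addrC subrK.
  by rewrite (rmorph1 (real_complex R)) mul1r.
apply: le_lt_trans (ler_normB _ _) _; apply: ler_ltD; last exact: near_z.
rewrite normrM ger0_norm ?ler0c ?(ltW r2_gt0) // -[leRHS]mulr1.
by rewrite ler_wpM2l ?ler0c ?(ltW r2_gt0) //; apply: (z_disc j).1.
Qed.
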